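(* Let $\{X_\alpha,f_{\alpha\beta},D\}$ be an inverse limit system for which each factor space $X_\alpha$ is non-empty, compact and Hausdorff, each bonding function $f_{\alpha\beta}:X_\beta\to 2^{X_\alpha}$ is upper semi-continuous and surjective, and $D$ is totally ordered. If, for some $\alpha\preceq\beta$ in $D$, the graph of $f_{\alpha\beta}$ is not connected, then $\varprojlim\mathbf{f}$ is not connected.
   Context: For a non-empty compact Hausdorff space $X$, $2^X$ denotes the set of non-empty compact subsets of $X$. For non-empty compact Hausdorff spaces $X,Y$, the graph of $f:X\to 2^Y$ is $\{(x,y)\in X\times Y\mid y\in f(x)\}$; $f$ is upper semi-continuous (u.s.c.) if for all $x\in X$ and every open $V\subseteq Y$ containing $f(x)$ there is an open $U\subseteq X$ containing $x$ with $f(u)\subseteq V$ for each $u\in U$ (equivalently, its graph is closed). $f$ is surjective if for every $y\in Y$ the set $f^{-1}(y)=\{x\in X\mid y\in f(x)\}$ is non-empty. For u.s.c. $f:X\to 2^Y$ and $g:Y\to 2^Z$, $(g\circ f)(x)=\{z\in Z\mid \exists y\in Y \text{ with } y\in f(x) \text{ and } z\in g(y)\}$. A totally ordered index set is a set $D$ with a reflexive, transitive, antisymmetric and total relation $\preceq$. An inverse limit system $\{X_\alpha,f_{\alpha\beta},D\}$ consists of compact Hausdorff spaces $X_\alpha$ and u.s.c. functions $f_{\alpha\beta}:X_\beta\to 2^{X_\alpha}$ for $\alpha\preceq\beta$ in $D$, where $f_{\alpha\alpha}$ is the identity on $X_\alpha$ (i.e. $f_{\alpha\alpha}(x)=\{x\}$),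 such that the collection $\mathbf{f}=\{f_{\alpha\beta}\mid\alpha\preceq\beta\in D\}$ is exact: $f_{\alpha\beta}\circ f_{\beta\eta}=f_{\alpha\eta}$ for all $\alpha\preceq\beta\preceq\eta$ in $D$. The inverse limit is $\varprojlim\mathbf{f}=\{\mathbf{x}\in\prod_{\alpha\in D}X_\alpha\mid x_\alpha\in f_{\alpha\beta}(x_\beta)\ \forall\,\alpha\preceq\beta\in D\}$, with the subspace topology from the product topology. *)

(* Defs.v *)
From HB Require Import structures.
From mathcomp Require Import all_boot all_order.
From mathcomp Require Import boolp classical_sets topology.

Set Implicit Arguments.
Unset Strict Implicit.
Unset Printing Implicit Defensive.

Import Order.TTheory.

Local Open Scope classical_set_scope.
Local Open Scope order_scope.

(* The set 2^Y of non-empty compact subsets of Y. *)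
Record hyperspace (Y : topologicalType) := Hyperspace {
  hset :> set Y;
  hset_neq0 : hset !=set0;
  hset_compact : compact hset
}.

Section SetValued.
Context {X Y : topologicalType}.
Implicit Type f : X -> hyperspace Y.

Definition sv_graph f : set (X * Y) := [set xy | hset (f xy.1) xy.2].

Definition usc f := forall (x : X) (V : set Y), open V -> f x `<=` V ->
  exists2 U : set X, open_nbhs x U & forall u, U u -> f u `<=` V.

Definition sv_fiber f (y : Y) : set X := [set x | hset (f x) y].

Definition sv_surjective f := forall y : Y, sv_fiber f y !=set0.

End SetValued.

(* Valued in plain sets: the values of g o f are known to lie in 2^Z only when
   f and g are upper semi-continuous. *)
Definition sv_comp {X Y Z : topologicalType} (g : Y -> hyperspace Z)
    (f : X -> hyperspace Y) (x : X) : set Z :=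
  [set z | exists y : Y, hset (f x) y /\ hset (g y) z].

Section InverseLimit.
Context {d : Order.disp_t} {D : orderType d} (X : D -> topologicalType).
Variable f : forall a b : D, a <= b -> X b -> hyperspace (X a).

Record inverse_limit_system : Prop := InverseLimitSystem {
  ils_compact : forall a, compact [set: X a];
  ils_hausdorff : forall a, hausdorff_space (X a);
  ils_usc : forall a b (ab : a <= b), usc (f ab);
  ils_id : forall a (aa : a <= a) (x : X a), f aa x = [set x] :> set (X a);
  ils_exact : forall a b c (ab : a <= b) (bc : b <= c) (ac : a <= c) (x : X c),
    sv_comp (f ab) (f bc) x = f ac x
}.

(* The type prod_topology X is forall a, X a with the product topology. *)
Definition inverse_limit : set (prod_topology X) :=
  [set x | forall a b (ab : a <= b), hset (f ab (x b)) (x a)].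

End InverseLimit.

(* Main.v *)
Require Import Defs.
From mathcomp Require Import all_boot all_order.
From mathcomp Require Import boolp classical_sets topology.

(** The continuous map [x |-> (x b, x a)] sends the inverse limit onto the
    graph of [f a b]; a continuous image of a connected space being connected,
    only surjectivity is at stake.  Given [q] in [f a b p], threads over a finite
    set of indices are extended one index [c] at a time: exactness supplies a
    value at [c] between the nearest indices below and above [c] (surjectivity,
    resp. non-emptiness of values, if one of the two is missing), and exactness
    again gives compatibility with all other indices.  Closedness of the graphs
    and compactness of the product then yield a full thread through [p], [q]. *)

Import Order.TTheory.

Local Open Scope classical_set_scope.
Local Open Scope order_scope.

(** By regularity, a point [y] outside the compact set [f x] has a neighbourhood [N] whose closure
    misses [f x]. Upper semi-continuity at [x], for the complement of that closure, gives [U] such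
    that no graph point lies over [U] with value in [N]. *)
Lemma usc_closed_graph {X Y : topologicalType} (f : X -> hyperspace Y) :
  compact [set: Y] -> hausdorff_space Y -> usc f -> closed (sv_graph f).
Proof.
move=> cptY hausY f_usc [x y] cl_xy; apply: contrapT => /= fxNy.
have open_fxC : open (~` hset (f x)).
  exact/closed_openC/(compact_closed hausY)/hset_compact.
have [N yN clN] : exists2 N, nbhs y N & closure N `<=` ~` hset (f x).
  apply: (compact_regular hausY cptY); first exact: filterT.
  exact: open_nbhs_nbhs.
have [|z fxz|U xU fU] := f_usc x (~` closure N).
- exact/closed_openC/closed_closure.
- by move=> /clN.
have [[u v] [/= fuv [Uu Nv]]] : sv_graph f `&` (U `*` N) !=set0.
  by apply: cl_xy; exists (U, N) => //=; split => //; exact: open_nbhs_nbhs.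
exact: (fU u Uu v fuv (subset_closure Nv)).
Qed.

Lemma continuous_proj_pair {I : eqType} (T : I -> topologicalType) (i j : I) :
  continuous (fun x : prod_topology T => (x i, x j)).
Proof.
have ev k : continuous (fun x : prod_topology T => x k).
  by move=> x; exact: proj_continuous.
by move=> x; exact: (cvg_pair (ev i x) (ev j x)).
Qed.

(** The relation is kept abstract so that [>=%O] yields maxima and [<=%O] minima. *)
Lemma seq_extremum {T : eqType} (r : rel T) (s : seq T) :
  total r -> transitive r ->
  s = [::] \/ exists2 m, m \in s & {in s, forall x, r m x}.
Proof.
move=> r_total r_trans; elim: s => [|x s [->|[m ms m_ext]]]; first by left.
  right; exists x; rewrite ?mem_head// => y; rewrite inE => /eqP->.
  by have := r_total x x; rewrite orbb.
right; have [xm|mx] := orP (r_total x m).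
  exists x; rewrite ?mem_head// => y; rewrite inE => /predU1P[->|/m_ext].
    by have := r_total x x; rewrite orbb.
  exact: r_trans.
by exists m; rewrite ?inE ?ms ?orbT// => y /predU1P[->|/m_ext].
Qed.

Section Threads.
Context {d : Order.disp_t} {D : orderType d} {X : D -> topologicalType}.
Context {f : forall a b : D, a <= b -> X b -> hyperspace (X a)}.
Hypothesis f_ils : inverse_limit_system f.
Hypothesis X_neq0 : forall a : D, [set: X a] !=set0.
Hypothesis f_surj : forall (a b : D) (ab : a <= b), sv_surjective (f a b ab).
Implicit Types (a b c : D) (s : seq D) (x : prod_topology X).

Let f_refl a (aa : a <= a) (y z : X a) : hset (f a a aa y) z <-> z = y.
Proof. by rewrite (ils_id f_ils). Qed.

Let f_trans a b c (ab : a <= b) (bc : b <= c) (ac : a <= c)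
    (z : X c) (y : X b) (w : X a) :
  hset (f b c bc z) y -> hset (f a b ab y) w -> hset (f a c ac z) w.
Proof. by move=> zy yw; rewrite -(ils_exact f_ils ab bc); exists y. Qed.

(** Coordinates outside [s] stay free, so that all these sets live in the one compact product. *)
Definition finite_threads s : set (prod_topology X) :=
  [set x | forall a b (ab : a <= b), a \in s -> b \in s ->
     hset (f a b ab (x b)) (x a)].

Lemma finite_threads_dfwith s c x (y : X c) : c \notin s ->
  finite_threads s x ->
  (forall a (ac : a <= c), a \in s -> hset (f a c ac y) (x a)) ->
  (forall b (cb : c <= b), b \in s -> hset (f c b cb (x b)) y) ->
  finite_threads (c :: s) (dfwith x y).
Proof.
move=> cNs xs lo hi a b ab; rewrite !inE.
have s_neq e : e \in s -> c != e by move=> es; apply: contraNneq cNs => ->.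
move=> /predU1P[ac|aS] /predU1P[bc|bS].
- by subst a b; exact/f_refl.
- by subst a; rewrite dfwith_in dfwith_out ?s_neq//; exact: hi.
- by subst b; rewrite dfwith_in dfwith_out ?s_neq//; exact: lo.
- by rewrite !dfwith_out ?s_neq//; exact: xs.
Qed.

Lemma finite_threads_interpolate s c x : finite_threads s x ->
  exists y : X c,
    (forall a (ac : a <= c), a \in s -> hset (f a c ac y) (x a)) /\
    (forall b (cb : c <= b), b \in s -> hset (f c b cb (x b)) y).
Proof.
move=> xs.
(* Compatibility of [y] with the largest index [l] of [s] below [c] suffices: any lower [a] is
   reached through [l] by exactness. Dually for [hi]. *)
have lo l (lc : l <= c) (y : X c) : l \in s -> hset (f l c lc y) (x l) ->
    {in [seq a <- s | a <= c], forall a, a <= l} ->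
    forall a (ac : a <= c), a \in s -> hset (f a c ac y) (x a).
  move=> ls fyl l_max a ac aS.
  have al : a <= l by apply: l_max; rewrite mem_filter ac.
  exact: (f_trans a l c al lc ac _ _ _ fyl (xs _ _ al aS ls)).
have hi u (cu : c <= u) (y : X c) : u \in s -> hset (f c u cu (x u)) y ->
    {in [seq b <- s | c <= b], forall b, u <= b} ->
    forall b (cb : c <= b), b \in s -> hset (f c b cb (x b)) y.
  move=> us fuy u_min b cb bS.
  have ub : u <= b by apply: u_min; rewrite mem_filter cb.
  exact: (f_trans c u b cu ub cb _ _ _ (xs _ _ ub us bS) fuy).
have ge_trans : transitive (>=%O : rel D).
  by move=> n m p nm pn; exact: le_trans pn nm.
have ge_total : total (>=%O : rel D) by move=> m n; exact: le_total.
have none (P : pred D) a : [seq e <- s | P e] = [::] -> P a -> a \notin s.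
  by move=> sP Pa; have := in_nil a; rewrite -sP mem_filter Pa => /= ->.
have [s_lo|[l]] := seq_extremum >=%O [seq a <- s | a <= c] ge_total ge_trans;
  have [s_hi|[u]] := seq_extremum <=%O [seq b <- s | c <= b] le_total le_trans.
- have [y _] := X_neq0 c; exists y.
  by split=> e ce es; [move: (none _ _ s_lo ce)|move: (none _ _ s_hi ce)];
    rewrite es.
- rewrite mem_filter => /andP[cu us] u_min.
  have [y fuy] := hset_neq0 (f c u cu (x u)).
  exists y; split; last exact: hi fuy _.
  by move=> a ac aS; move: (none _ _ s_lo ac); rewrite aS.
- rewrite mem_filter => /andP[lc ls] l_max.
  have [y fyl] := f_surj l c lc (x l); exists y; split; first exact: lo fyl _.
  by move=> b cb bS; move: (none _ _ s_hi cb); rewrite bS.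
(* Exactness factors the bonding function from [u] to [l] through [X c]; the intermediate point is
   the required [y]. *)
- rewrite !mem_filter => /andP[cu us] u_min /andP[lc ls] l_max.
  have lu := le_trans lc cu.
  have := xs l u lu ls us; rewrite -(ils_exact f_ils lc cu) => -[y [fuy fyl]].
  by exists y; split; [exact: lo fyl _|exact: hi fuy _].
Qed.

(** Only the coordinate of a new index is ever overwritten, so the values prescribed on [t] survive
    the induction on [s]. *)
Lemma finite_threads_extend s t x : finite_threads t x ->
  exists2 z, finite_threads (s ++ t) z & {in t, forall a, z a = x a}.
Proof.
move=> xt; elim: s => [|c s [z zs zx]]; first by exists x.
have [cs|cNs] := boolP (c \in s ++ t).
  exists z => // a b ab.
  have sub_s e : e \in c :: (s ++ t) -> e \in s ++ t.
    by rewrite inE => /predU1P[->|].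
  by move=> /sub_s aS /sub_s bS; exact: zs.
have [y [lo hi]] := finite_threads_interpolate _ c _ zs.
exists (dfwith z y); first exact: finite_threads_dfwith.
move=> a ta; rewrite dfwith_out ?zx//.
by apply: contraNneq cNs => ->; rewrite mem_cat ta orbT.
Qed.

Lemma pair_thread a b (ab : a <= b) (p : X b) (q : X a) : hset (f a b ab p) q ->
  exists x, [/\ finite_threads [:: a; b] x, x b = p & x a = q].
Proof.
move=> pq; pose x0 : prod_topology X := fun e => sval (cid (X_neq0 e)).
pose x1 : prod_topology X := dfwith x0 p.
have x1b : x1 b = p by exact: dfwith_in.
have thr1 : finite_threads [:: b] x1.
  by move=> e e' ee'; rewrite !inE => /eqP ? /eqP ?; subst e e'; exact/f_refl.
(* If [a = b], the bonding function is the identity, which forces [q = p]. *)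
have [a_b|a_neq_b] := eqVneq a b.
  subst b; exists x1; split=> //; last by move/f_refl: pq => ->.
  by move=> e e' ee' ea ea'; apply: thr1; move: ea ea'; rewrite !inE !orbb.
exists (dfwith x1 q); split; last exact: dfwith_in.
- apply: finite_threads_dfwith => //; first by rewrite inE.
    move=> e ea; rewrite inE => /eqP eb; subst e.
    by case/eqP: a_neq_b; apply/le_anti/andP.
  move=> e ae; rewrite inE => /eqP eb; subst e.
  (* Bonding functions take the proof of the inequality as an argument; any two such proofs are
     equal. *)
  by rewrite x1b (bool_irrelevance ae ab).
- by rewrite dfwith_out.
Qed.

Lemma closed_bonding a b (ab : a <= b) :
  closed [set x : prod_topology X | hset (f a b ab (x b)) (x a)].
Proof.
pose h (x : prod_topology X) := (x b, x a).
have -> : [set x | hset (f a b ab (x b)) (x a)] = h @^-1` sv_graph (f a b ab).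
  by [].
apply: preimage_closed.
  by move=> x _; exact: continuous_proj_pair.
apply: usc_closed_graph.
- exact: ils_compact f_ils a.
- exact: ils_hausdorff f_ils a.
- exact: ils_usc f_ils _ _ ab.
Qed.

Lemma closed_coordinate a (y : X a) : closed [set x : prod_topology X | x a = y].
Proof.
apply: (@preimage_closed _ _ (fun x : prod_topology X => x a) [set y]).
  by move=> x _; exact: proj_continuous.
exact/accessible_closed_set1/hausdorff_accessible/(ils_hausdorff f_ils).
Qed.

Lemma inverse_limit_through a b (ab : a <= b) (p : X b) (q : X a) :
  hset (f a b ab p) q ->
  exists x, [/\ inverse_limit f x, x b = p & x a = q].
Proof.
move=> pq.
(* These sets form a filter base: [B (s ++ t)] lies in both [B s] and [B t], and each is inhabited
   by extending the thread through [p] and [q] on [[:: a; b]]. *)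
pose B s := finite_threads s `&` [set x | x b = p /\ x a = q].
pose F := filter_from [set: seq D] B.
have F_filter : Filter F.
  apply: filter_from_filter; first by exists [::].
  move=> s t _ _; exists (s ++ t) => // x [xst x_pq].
  by split; split=> // e e' ee' es es'; apply: xst;
    rewrite mem_cat ?es ?es' ?orbT.
have F_proper : ProperFilter F.
  apply: filter_from_proper => s _.
  have [x [xab xb xa]] := pair_thread a b ab p q pq.
  have [z zs zx] := finite_threads_extend s _ _ xab.
  exists z; split.
    by move=> e e' ee' es es'; apply: zs; rewrite mem_cat ?es ?es'.
  by split; rewrite zx ?inE ?eqxx ?orbT.
have cpt : compact [set x : prod_topology X | forall e, [set: X e] (x e)].
  exact: (@tychonoff D X (fun e => [set: X e]) (ils_compact f_ils)).
have [|x [_ clFx]] := cpt F F_proper; first by exists [::].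
(* A cluster point lies in every closed member of [F]. Each bonding condition is such a member,
   containing [B [:: e; e']], and so are the two coordinate conditions, which contain [B [::]]. *)
have F_closed C : closed C -> F C -> C x.
  by move=> C_closed FC; apply: C_closed => N xN; exact: clFx.
exists x; split.
- move=> e e' ee'; apply: F_closed (closed_bonding e e' ee') _.
  by exists [:: e; e'] => // z [zee' _]; apply: zee'; rewrite !inE eqxx ?orbT.
- by apply: F_closed (closed_coordinate b p) _; exists [::] => // z [_ []].
- by apply: F_closed (closed_coordinate a q) _; exists [::] => // z [_ []].
Qed.

End Threads.

Theorem theorem5p5 (d : Order.disp_t) (D : orderType d)
    (X : D -> topologicalType)
    (f : forall a b : D, a <= b -> X b -> hyperspace (X a))
    (f_ils : inverse_limit_system f)
    (X_neq0 : forall a : D, [set: X a] !=set0)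
    (f_surj : forall (a b : D) (ab : a <= b), sv_surjective (f a b ab)) :
  (exists (a b : D) (ab : a <= b), ~ connected (sv_graph (f a b ab))) ->
  ~ connected (inverse_limit f).
Proof.
move=> [a [b [ab graph_disconn]]] lim_conn; apply: graph_disconn.
pose h (x : prod_topology X) := (x b, x a).
have -> : sv_graph (f a b ab) = h @` inverse_limit f.
  apply/seteqP; split=> [[p q] /= pq|_ [x lim_x <-]]; last exact: lim_x.
  have [x [lim_x xb xa]] :=
    inverse_limit_through f_ils X_neq0 f_surj a b ab p q pq.
  by exists x; rewrite // /h xb xa.
apply: connected_continuous_connected => //; apply: continuous_subspaceT.
exact: continuous_proj_pair.
Qed.
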